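(* Consider allocating a set of $m\ge 1$ indivisible items among $n=2$ agents with additive valuations. A deterministic DSIC mechanism is $\mathrm{SD}^+$efficient (i.e. outputs an $\mathrm{SD}^+$efficient allocation, with respect to the reported valuations, on every input) if and only if it is a serial dictatorship. This holds even when agents have ternary valuations, i.e., when the set of possible valuations (and reports) is restricted so that for all agents $i$ and items $j$ we have $v_{i,j}\in\{0,x,y\}$, for some fixed reals $y>x>0$.
   Context: Items are $[m]=\{1,\dots,m\}$, agents are $[n]$. Each agent $i$ has a private valuation vector $\mathbf v_i=(v_{i,1},\dots,v_{i,m})\in\mathbb R^m_{\ge 0}$. An allocation is $\mathbf x\in\{0,1\}^{n\times m}$ with $\sum_i x_{i,j}=1$ for every item $j$; $\mathbf x_i$ is the bundle of agent $i$, and $u_i(\mathbf x)=u_i(\mathbf x_i)=\sum_j v_{i,j}x_{i,j}$. A deterministic mechanism is a function $\mathbf x(\cdot)$ mapping each report profile $\mathbf b=(\mathbf b_1,\dots,\mathbf b_n)$ to an allocation $\mathbf x(\mathbf b)$. DSIC: for every agent $i$, true valuation $\mathbf v_i$, report $\mathbf b_i$ and reports $\mathbf b_{-i}$ of the others, $u_i(\mathbf x(\mathbf v_i,\mathbf b_{-i}))\ge u_i(\mathbf x(\mathbf b_i,\mathbf b_{-i}))$, where $u_i$ is computed with $\mathbf v_i$. Serial dictatorship (two agents): there is a fixed agent (the dictator) such that, for every report profile, the dictator receives every item for which she reports a positive value, and every item for which the dictator reports value zero but the other agent reports a positive value goes to the other agent; items reported as zero-valued by both agents are allocated in some arbitrary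 deterministic manner. $\mathrm{SD}^+$efficiency: Let $\mathbf p_i$ be the ranking of the items in decreasing order of agent $i$'s value, ties broken in favor of the lower index, with $\mathbf p_i(k)$ the $k$-th ranked item. Let $m_i=|\{j: v_{i,j}>0\}|$. For bundles $\mathbf a,\mathbf b\in\{0,1\}^m$, write $\mathbf a\succeq_i^+\mathbf b$ iff $\sum_{k=1}^{\ell}a_{\mathbf p_i(k)}\ge\sum_{k=1}^{\ell}b_{\mathbf p_i(k)}$ for all $\ell\in\{1,\dots,m_i\}$, and $\mathbf a\succ_i^+\mathbf b$ iff $\mathbf a\succeq_i^+\mathbf b$ and at least one of these inequalities (for some $\ell\le m_i$) is strict. An allocation $\mathbf x$ is $\mathrm{SD}^+$efficient iff there is no allocation $\mathbf y$ with $\mathbf y_i\succeq_i^+\mathbf x_i$ for all agents $i$ and $\mathbf y_j\succ_j^+\mathbf x_j$ for some agent $j$. *)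

(* Defs.v *)
From mathcomp Require Import all_boot all_order all_algebra.
From mathcomp Require Import reals.

Set Implicit Arguments.
Unset Strict Implicit.
Unset Printing Implicit Defensive.

Import Order.TTheory GRing.Theory Num.Theory.
Local Open Scope ring_scope.

Definition bundle (m : nat) := 'I_m -> bool.

(* The matrix [x] is the 0/1 matrix with one row per agent and one column per
   item; the row [x i] is the bundle of agent [i]. *)
Definition is_allocation (n m : nat) (x : 'M[bool]_(n, m)) : bool :=
  [forall j, (\sum_(i < n) (x i j : nat) == 1)%N].

Definition allocation (n m : nat) := {x : 'M[bool]_(n, m) | is_allocation x}.

Definition bundle_of (n m : nat) (x : allocation n m) (i : 'I_n) : bundle m :=
  fun j => val x i j.

Section Mechanisms.

Variable R : realType.

Definition utility (m : nat) (v : 'I_m -> R) (a : bundle m) : R :=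
  \sum_(j < m) v j * (a j)%:R.

(* The set [D] of admissible item values is carried by the type of reports, so
   that a mechanism is a function defined exactly on the admissible profiles. *)
Definition valuation (D : pred R) (m : nat) := {ffun 'I_m -> {z : R | D z}}.

Definition values (D : pred R) (m : nat) (v : valuation D m) : 'I_m -> R :=
  fun j => val (v j).

Definition profile (D : pred R) (n m : nat) := {ffun 'I_n -> valuation D m}.

Definition mechanism (D : pred R) (n m : nat) := profile D n m -> allocation n m.

Definition nonneg_values : pred R := fun z => 0 <= z.

Definition ternary_values (x y : R) : pred R :=
  fun z => [|| z == 0, z == x | z == y].

(* The profile (v, b_{-i}). *)
Definition replace (D : pred R) (n m : nat)
    (b : profile D n m) (i : 'I_n) (v : valuation D m) : profile D n m :=
  [ffun k => if k == i then v else b k].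

Definition DSIC (D : pred R) (n m : nat) (M : mechanism D n m) : Prop :=
  forall (i : 'I_n) (v : valuation D m) (b : profile D n m),
    utility (values v) (bundle_of (M b) i)
      <= utility (values v) (bundle_of (M (replace b i v)) i).

(* [j] is ranked before [k]; the relation is reflexive and total, as [sort]
   requires. *)
Definition ranked_before (m : nat) (v : 'I_m -> R) : rel 'I_m :=
  fun j k => (v k < v j) || ((v j == v k) && (j <= k)%N).

Definition ranking (m : nat) (v : 'I_m -> R) : seq 'I_m :=
  sort (ranked_before v) (enum 'I_m).

Definition num_positive (m : nat) (v : 'I_m -> R) : nat :=
  #|[set j : 'I_m | 0 < v j]|.

Definition top_count (m : nat) (v : 'I_m -> R) (a : bundle m) (l : nat) : nat :=
  (\sum_(j <- take l (ranking v)) (a j : nat))%N.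

Definition sd_plus_weak (m : nat) (v : 'I_m -> R) (a b : bundle m) : Prop :=
  forall l : nat, (1 <= l <= num_positive v)%N ->
    (top_count v b l <= top_count v a l)%N.

Definition sd_plus_strict (m : nat) (v : 'I_m -> R) (a b : bundle m) : Prop :=
  sd_plus_weak v a b /\
  exists2 l : nat, (1 <= l <= num_positive v)%N &
    (top_count v b l < top_count v a l)%N.

Definition sd_plus_efficient (n m : nat) (v : 'I_n -> 'I_m -> R)
    (x : allocation n m) : Prop :=
  ~ exists y : allocation n m,
      (forall i : 'I_n, sd_plus_weak (v i) (bundle_of y i) (bundle_of x i)) /\
      (exists k : 'I_n, sd_plus_strict (v k) (bundle_of y k) (bundle_of x k)).

Definition sd_plus_efficient_mechanism (D : pred R) (n m : nat)
    (M : mechanism D n m) : Prop :=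
  forall b : profile D n m, sd_plus_efficient (fun i => values (b i)) (M b).

(* Items on which both reports are zero are left unconstrained. *)
Definition serial_dictatorship (D : pred R) (m : nat)
    (M : mechanism D 2 m) : Prop :=
  exists d : 'I_2, forall (b : profile D 2 m) (j : 'I_m),
    (0 < values (b d) j -> bundle_of (M b) d j) /\
    (forall i : 'I_2, i != d -> values (b d) j = 0 -> 0 < values (b i) j ->
       bundle_of (M b) i j).

End Mechanisms.

(* Main.v *)
Require Import Defs.
From mathcomp Require Import all_boot all_order all_algebra.
From mathcomp Require Import reals.

Set Implicit Arguments.
Unset Strict Implicit.
Unset Printing Implicit Defensive.

Import Order.TTheory GRing.Theory Num.Theory.
Local Open Scope ring_scope.

(** If both agents value only item [j], one of them, say [d], receives it.
    Against this report of the other agent, [d] receives every set [P]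
    containing [j] that she reports with value [y] on [j] and [x] on the rest:
    by induction the menu offers [P] minus one item [k != j], which is worth
    more than [P] minus [j], and efficiency already gives her [P] minus [j].
    Strategyproofness for both agents then makes [d] receive [j] at every
    profile where she values it. So each item has its own dictator; if [j] and
    [k] had different ones, each of whom prefers the other's item, swapping the
    two items would be an improvement. *)

(** * Rankings, prefix counts and the order $\succeq^+$ *)

Section Ranking.

Variables (R : realType) (m : nat).
Implicit Types (v : 'I_m -> R) (a b : bundle m).

Let rank v (j : 'I_m) := index j (ranking v).

Lemma ranked_before_total v : total (ranked_before v).
Proof.
move=> j k; rewrite /ranked_before.
by case: (ltgtP (v j) (v k)) => //= _; rewrite leq_total.
Qed.

Lemma ranked_before_trans v : transitive (ranked_before v).
Proof.
move=> k j l; rewrite /ranked_before.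
case/orP=> [kj|/andP[/eqP-> jk]]; case/orP=> [lk|/andP[/eqP<- kl]].
- by rewrite (lt_trans lk kj).
- by rewrite kj.
- by rewrite lk.
- by rewrite eqxx (leq_trans jk kl) orbT.
Qed.

Lemma mem_ranking v j : j \in ranking v.
Proof. by rewrite mem_sort mem_enum. Qed.

Lemma ranking_uniq v : uniq (ranking v).
Proof. by rewrite sort_uniq enum_uniq. Qed.

Lemma rank_le v j k : (rank v j <= rank v k)%N -> v k <= v j.
Proof.
move=> jk.
have : ranked_before v j k.
  apply: (@sorted_leq_index _ (ranked_before v) _ _ (ranking v)) => //;
    rewrite ?mem_ranking //.
  - exact: ranked_before_trans.
  - by move=> i; have := ranked_before_total v i i; rewrite orbb.
  - exact: sort_sorted (@ranked_before_total v) _.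
by case/orP=> [/ltW|/andP[/eqP-> _]].
Qed.

Lemma lt_rank v j k : v k < v j -> (rank v j < rank v k)%N.
Proof.
by move=> kj; rewrite ltnNge; apply: contraTN kj => /rank_le; rewrite leNgt.
Qed.

Lemma top_countE v a l :
  top_count v a l = (\sum_(j | rank v j < l) (a j : nat))%N.
Proof.
rewrite /top_count -[RHS]big_filter; apply: perm_big; apply: uniq_perm.
- exact: take_uniq (ranking_uniq v).
- by rewrite filter_uniq // index_enum_uniq.
move=> j; rewrite mem_filter mem_index_enum andbT.
by rewrite in_take // mem_ranking.
Qed.

Lemma card_rank v l : (l <= m)%N -> #|[set j | (rank v j < l)%N]| = l.
Proof.
move=> lm; have ss : size (ranking v) = m by rewrite size_sort size_enum_ord.
rewrite cardE -[RHS](size_takel (s := ranking v)) ?ss //; apply: perm_size.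
apply: uniq_perm; rewrite ?enum_uniq ?take_uniq ?ranking_uniq // => j.
by rewrite mem_enum inE in_take // mem_ranking.
Qed.

(** Items ranked before a positive item are positive, and positive items precede all others. Thus
    prefixes of length at most [num_positive v] contain only positive items. *)
Lemma rank_lt_num_positive v j : (rank v j < num_positive v)%N = (0 < v j).
Proof.
have rm i : (rank v i < m)%N.
  by rewrite -[ltnRHS]size_enum_ord -(size_sort (ranked_before v)) index_mem
    mem_ranking.
have [vj|vj] := ltP 0 (v j).
  rewrite -(card_rank v (rm j)); apply: subset_leq_card; apply/subsetP => k.
  by rewrite !inE ltnS => /rank_le; apply: lt_le_trans.
apply/negbTE; rewrite -leqNgt -(card_rank v (ltnW (rm j))).
apply: subset_leq_card; apply/subsetP => k; rewrite !inE => vk.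
exact: lt_rank (le_lt_trans vj vk).
Qed.

Lemma top_count_le v a b l :
    (forall j, 0 < v j -> a j -> b j) -> (l <= num_positive v)%N ->
  (top_count v a l <= top_count v b l)%N.
Proof.
move=> ab lv; rewrite !top_countE; apply: leq_sum => j jl.
have := ab j; rewrite -rank_lt_num_positive (leq_trans jl lv) => /(_ isT).
by case: (a j) => // ->.
Qed.

Lemma sd_plus_weak_sub v a b :
  (forall j, 0 < v j -> a j -> b j) -> sd_plus_weak v b a.
Proof. by move=> ab l /andP[_]; apply: top_count_le. Qed.

(** The prefix ending at [j] gives the strict inequality: its items are worth at least [v j], hence
    are positive, so none of them is lost. *)
Lemma sd_plus_strict_sub v a b j :
    (forall k, 0 < v k -> a k -> b k) -> 0 < v j -> ~~ a j -> b j ->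
  sd_plus_strict v b a.
Proof.
move=> ab vj aj bj; split; first exact: sd_plus_weak_sub.
exists (rank v j).+1; first by rewrite rank_lt_num_positive.
rewrite !top_countE (bigD1 j) //= [ltnRHS](bigD1 j) //= bj (negPf aj).
rewrite add0n add1n ltnS; apply: leq_sum => k /andP[kj _].
have := ab k; rewrite (lt_le_trans vj (rank_le _)); last by rewrite -ltnS.
by move=> /(_ isT); case: (a k) => // ->.
Qed.

(** Only [j] may be lost, and [k] is ranked before it. Every prefix containing [j] also contains
    [k], whose gain makes up for the loss, while the prefix ending at [k] omits [j] and is
    strict. *)
Lemma sd_plus_strict_swap v a b j k :
    v j < v k -> 0 < v k -> ~~ a k -> b k ->
    (forall i, i != j -> a i -> b i) ->
  sd_plus_strict v b a.
Proof.
move=> vjk vk ak bk ab; have rjk := lt_rank vjk.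
have jk : j != k by apply: contraTneq vjk => ->; rewrite ltxx.
split=> [l _|]; last exists (rank v k).+1.
- rewrite !top_countE; have [jl|lj] := ltnP (rank v j) l; last first.
    apply: leq_sum => i il; have := ab i.
    rewrite (contraTneq _ il) => [/(_ isT)|->]; last by rewrite -leqNgt.
    by case: (a i) => // ->.
  have kl := ltn_trans rjk jl.
  rewrite (bigD1 k) //= (bigD1 j) ?jl //= [leqRHS](bigD1 k) //=.
  rewrite [in leqRHS](bigD1 j) ?jl //= bk (negPf ak) add0n.
  apply: (leq_add (leq_b1 _)); apply: leq_trans (leq_addl _ _).
  apply: leq_sum => i /andP[_ /ab]; by case: (a i) => // ->.
- by rewrite rank_lt_num_positive.
rewrite !top_countE (bigD1 k) //= [ltnRHS](bigD1 k) //= bk (negPf ak).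
rewrite add0n add1n ltnS; apply: leq_sum => i /andP[ik _].
have := ab i; rewrite (contraTneq _ ik) => [/(_ isT)|->].
  by case: (a i) => // ->.
by rewrite -leqNgt.
Qed.

(** At [l = num_positive v] the prefix consists of all positive items, and [a] attains the maximal
    count there. *)
Lemma sd_plus_weak_full v a b :
    (forall j, 0 < v j -> a j) -> sd_plus_weak v b a ->
  forall j, 0 < v j -> b j.
Proof.
move=> va ba j vj; apply/negPn/negP => bj.
have nv : (1 <= num_positive v <= num_positive v)%N.
  by rewrite leqnn andbT; apply/card_gt0P; exists j; rewrite inE.
have := ba _ nv; apply/negP; rewrite -ltnNge.
rewrite !top_countE (bigD1 j) ?rank_lt_num_positive //=.
rewrite [ltnRHS](bigD1 j) ?rank_lt_num_positive //= va // (negPf bj).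
rewrite add0n add1n ltnS; apply: leq_sum => k /andP[].
by rewrite rank_lt_num_positive => /va -> _; apply: leq_b1.
Qed.

Lemma utility_lt v a b j :
    (forall k, 0 <= v k) -> (forall k, 0 < v k -> a k -> b k) ->
    0 < v j -> ~~ a j -> b j ->
  utility v a < utility v b.
Proof.
move=> v0 ab vj aj bj; rewrite /utility (bigD1 j) //= [ltRHS](bigD1 j) //=.
rewrite bj (negPf aj) mulr0 mulr1; apply: ltr_leD => //; apply: ler_sum => k _.
have := v0 k; rewrite le_eqVlt => /orP[/eqP<-|vk]; first by rewrite !mul0r.
by rewrite ler_pM2l // ler_nat; have := ab k vk; case: (a k) => // ->.
Qed.

End Ranking.

(** * Allocations between two agents as complementary bundles *)

Section TwoAgents.

Variable m : nat.
Implicit Types (X : allocation 2 m) (i o : 'I_2).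

Lemma ord2P i o : i != o -> forall k, k = i \/ k = o.
Proof.
case: i o => -[|[|//]] ? [] [|[|//]] ? //= _ [] [|[|//]] ?;
  by [left; apply: val_inj | right; apply: val_inj].
Qed.

Lemma sum_ord2 i o (F : 'I_2 -> nat) : i != o -> (\sum_k F k = F i + F o)%N.
Proof.
move=> io; rewrite (bigD1 i) //= (bigD1 o) 1?eq_sym //= big1 ?addn0 // => k.
by case: (ord2P io k) => ->; rewrite eqxx ?andbF.
Qed.

Lemma bundle_of_other X i o j :
  i != o -> bundle_of X o j = ~~ bundle_of X i j.
Proof.
move=> io; have /forallP/(_ j) := valP X; rewrite (sum_ord2 _ io) /bundle_of.
by case: (val X i j); case: (val X o j).
Qed.

Lemma allocation_with i (a : bundle m) :
  exists2 X : allocation 2 m, bundle_of X i =1 a &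
    forall o, i != o -> bundle_of X o =1 (fun j => ~~ a j).
Proof.
(* Row [i] is [a], and the other row is its negation. *)
pose A : 'M[bool]_(2, m) := \matrix_(k, j) ((k == i) == a j).
have alA : is_allocation A.
  have [o io] : exists o, i != o.
    by case: (eqVneq i 0) => [->|i0]; [exists 1 | exists 0].
  apply/forallP => j; rewrite (sum_ord2 _ io) !mxE eqxx eq_sym.
  by rewrite [o == i]eq_sym (negPf io); case: (a j).
have iA : bundle_of (exist _ A alA) i =1 a.
  by move=> j; rewrite /bundle_of /= mxE eqxx; case: (a j).
by exists (exist _ A alA) => // o io j; rewrite (bundle_of_other _ _ io) iA.
Qed.

End TwoAgents.

(** * Efficiency of serial dictatorships, and the converse *)

Section Characterization.

Variables (R : realType) (D : pred R) (m : nat).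
Hypothesis D_ge0 : forall z, D z -> 0 <= z.
Implicit Types (M : mechanism D 2 m) (b : profile D 2 m) (u w : valuation D m).

Lemma values_ge0 u j : 0 <= values u j.
Proof. exact: D_ge0 (valP (u j)). Qed.

(** A weak improvement leaves the dictator all her positive items, and the other agent already holds
    every remaining item of positive value to that agent. *)
Lemma serial_dictatorship_efficient M :
  serial_dictatorship M -> sd_plus_efficient_mechanism M.
Proof.
move=> [d sd] b [Y [weakY [k [_ [l /andP[_ lk]]]]]].
have full := sd_plus_weak_full (fun j => (sd b j).1) (weakY d).
apply/negP; rewrite -leqNgt; apply: top_count_le lk => j vj Yj.
have [kd|kd] := eqVneq k d; first by rewrite kd in vj *; apply: (sd b j).1.
have dk : d != k by rewrite eq_sym.
have := values_ge0 (b d) j; rewrite le_eqVlt => /orP[/eqP dj|/full].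
  exact: (sd b j).2.
by rewrite (bundle_of_other _ _ kd) Yj.
Qed.

(** Three admissible values suffice for the converse, so one argument serves both domains. *)
Variables (x0 x y : {z : R | D z}).
Hypotheses (x00 : val x0 = 0) (x_gt0 : 0 < val x) (ltxy : val x < val y).
Variable M : mechanism D 2 m.
Hypotheses (dsic : DSIC M) (eff : sd_plus_efficient_mechanism M).

(** Otherwise handing [j] to [i] would help [i] and cost [o] nothing of positive value. *)
Lemma sole_positive b i o j : i != o ->
  0 < values (b i) j -> values (b o) j = 0 -> bundle_of (M b) i j.
Proof.
move=> io vi vo; apply/negPn/negP => nij; apply: (eff (b := b)).
have [Y Yi Yo] := allocation_with i (fun k => (k == j) || bundle_of (M b) i k).
have si : sd_plus_strict (values (b i)) (bundle_of Y i) (bundle_of (M b) i).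
  apply: (sd_plus_strict_sub _ vi nij); last by rewrite Yi eqxx.
  by move=> k _; rewrite Yi orbC => ->.
exists Y; split; last by exists i.
move=> k; have [->|->] := ord2P io k; first exact: si.1.
apply: sd_plus_weak_sub => l vl; rewrite Yo // (bundle_of_other _ _ io).
by have [lj|] := eqVneq l j; first by rewrite lj vo ltxx in vl.
Qed.

(** Profiles are written relative to a chosen agent, so that either agent can be cast as the
    dictator. *)
Let profile2 (i : 'I_2) u w : profile D 2 m :=
  [ffun k => if k == i then u else w].

Let profile2_eq i u w : profile2 i u w i = u.
Proof. by rewrite ffunE eqxx. Qed.

Let profile2_neq i o u w : i != o -> profile2 i u w o = w.
Proof. by rewrite eq_sym ffunE => /negPf->. Qed.

Let profile2_id i o b : i != o -> profile2 i (b i) (b o) = b.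
Proof.
move=> io; apply/ffunP => k; rewrite ffunE.
by have [->|->] := ord2P io k; rewrite ?eqxx // eq_sym (negPf io).
Qed.

Let dsicl i u u' w :
  utility (values u) (bundle_of (M (profile2 i u' w)) i)
    <= utility (values u) (bundle_of (M (profile2 i u w)) i).
Proof.
have := dsic i u (profile2 i u' w); congr (_ <= utility _ (bundle_of (M _) i)).
by apply/ffunP => k; rewrite !ffunE; case: eqP.
Qed.

Let dsicr i o u w w' : i != o ->
  utility (values w) (bundle_of (M (profile2 i u w')) o)
    <= utility (values w) (bundle_of (M (profile2 i u w)) o).
Proof.
move=> io; have := dsic o w (profile2 i u w').
congr (_ <= utility _ (bundle_of (M _) o)); apply/ffunP => k; rewrite !ffunE.
by have [->|->] := ord2P io k; rewrite ?eqxx ?(negPf io) // eq_sym (negPf io).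
Qed.

Let report (s : {z : R | D z}) j (P : {set 'I_m}) : valuation D m :=
  [ffun k => if k == j then s else if k \in P then x else x0].

Let reportE s j P k :
  values (report s j P) k
    = if k == j then val s else if k \in P then val x else 0.
Proof. by rewrite /values ffunE; case: ifP => // _; case: ifP. Qed.

(** Strategyproofness at this valuation compares only who receives [j]. *)
Let solo j := report x j set0.

Let soloE j k : values (solo j) k = if k == j then val x else 0.
Proof. by rewrite reportE inE. Qed.

Let utility_solo j (a : bundle m) :
  utility (values (solo j)) a = val x * (a j)%:R.
Proof.
rewrite /utility (bigD1 j) //= soloE eqxx big1 ?addr0 // => k /negPf kj.
by rewrite soloE kj mul0r.
Qed.

Let y_gt0 : 0 < val y. Proof. exact: lt_trans ltxy. Qed.

(** * The owner of an item receives it whenever she values it *)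

Section Dictator.

Variables (d o : 'I_2) (j : 'I_m).
Hypotheses (neq_do : d != o)
  (own : bundle_of (M (profile2 d (solo j) (solo j))) d j).

Lemma sole_against_solo u k : k != j -> 0 < values u k ->
  bundle_of (M (profile2 d u (solo j))) d k.
Proof.
move=> kj uk; apply: (sole_positive neq_do); first by rewrite profile2_eq.
by rewrite (profile2_neq _ _ neq_do) soloE (negPf kj).
Qed.

Lemma report_against_solo (P : {set 'I_m}) : j \notin P ->
  forall k, k \in j |: P ->
  bundle_of (M (profile2 d (report y j P) (solo j))) d k.
Proof.
have [n leP] := ubnP #|P|; elim: n P leP => // n IHn P leP jP k.
rewrite in_setU1; have [-> _|kj /= kP] := eqVneq k j; last first.
  by apply: sole_against_solo => //; rewrite reportE (negPf kj) kP.
(* If [P] is empty, [j] is the only valued item, and reporting [solo j] would secure it. *)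
apply/negPn/negP => naj; have [P0|[l lP]] := set_0Vmem P.
  have := dsicl d (report y j P) (solo j) (solo j); rewrite leNgt => /negP[].
  apply: (utility_lt (j := j)) => // [i|i|]; first exact: values_ge0.
    by rewrite reportE P0 inE; case: eqVneq => [->|] //; rewrite ltxx.
  by rewrite reportE eqxx.
have lj : l != j by apply: contraTneq lP => ->.
have ltPl : (#|P :\ l| < n)%N.
  by rewrite -ltnS (leq_trans _ leP) // ltnS [leqRHS](cardsD1 l) lP.
have jPl : j \notin P :\ l by rewrite in_setD1 (negPf jP) andbF.
have menu := IHn _ ltPl jPl.
(* Dropping [l] from the report secures [j] and [P :\ l] by induction. *)
have := dsicl d (report y j P) (report y j (P :\ l)) (solo j).
rewrite leNgt => /negP[].
set c := bundle_of _ _ in menu *; set a := bundle_of _ _.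
have ja : a j = false by apply: negbTE.
rewrite /utility (bigD1 j) //= (bigD1 l) //= [ltRHS](bigD1 j) //=.
rewrite [in ltRHS](bigD1 l) //= !reportE eqxx (negPf lj) lP ja.
rewrite (menu j) ?setU11 // mulr0 add0r mulr1 addrA.
(* Without [j], the item [l] brings at most [x], less than the [y] that the deviation gains from
   [j]; the deviation also receives all other items of [P]. *)
apply: ltr_leD.
  apply: le_lt_trans (_ : val x < _).
    by rewrite ger_pMr // lern1 leq_b1.
  by rewrite (lt_le_trans ltxy) // lerDl mulr_ge0 ?ler0n // ltW.
apply: ler_sum => i /andP[ij il]; rewrite reportE (negPf ij).
case: ifP => iP; last by rewrite !mul0r.
rewrite (menu i) ?in_setU1 ?in_setD1 ?il ?iP ?orbT //.
by rewrite ler_pM2l // ler_nat leq_b1.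
Qed.

(** If [d] missed [j], she would also miss it against [solo j], where another report secures all her
    positive items. *)
Lemma owner_takes b : 0 < values (b d) j -> bundle_of (M b) d j.
Proof.
move=> bj; apply/negPn/negP => nbj.
(* [b o] wins [j] against [b d], hence so does the report [solo j]. *)
have against : ~~ bundle_of (M (profile2 d (b d) (solo j))) d j.
  have := dsicr (b d) (solo j) (b o) neq_do.
  rewrite (profile2_id b neq_do) !utility_solo ler_pM2l // ler_nat.
  rewrite !(bundle_of_other _ _ neq_do) nbj.
  by case: (bundle_of _ _ _).
(* With [P] the other items that [d] values, [report y j P] wins all of [j |: P] against
   [solo j]. *)
pose P := [set k | 0 < values (b d) k] :\ j.
have menu := @report_against_solo P (negbT (setD11 _ _)).
have := dsicl d (b d) (report y j P) (solo j); rewrite leNgt => /negP[].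
apply: (utility_lt (j := j)) => // [k|k bk _|].
- exact: values_ge0.
- by apply: menu; rewrite in_setU1 in_setD1 inE bk andbT; case: eqP.
- by apply: menu; rewrite setU11.
Qed.

End Dictator.

(** * A single dictator for all items *)

Let owned d j := bundle_of (M (profile2 d (solo j) (solo j))) d j.

(** With equal reports, the profile does not depend on the agent it is written relative to. *)
Let owned_other d o j : d != o -> owned o j = ~~ owned d j.
Proof.
move=> neq_do; rewrite /owned -(bundle_of_other _ _ neq_do).
by congr (bundle_of (M _) _ _); apply/ffunP => k; rewrite !ffunE !if_same.
Qed.

Lemma owned_all d j k : owned d j -> owned d k.
Proof.
have [->//|jk] := eqVneq j k; move=> dj; apply/negPn/negP => ndk.
have kj : k != j by rewrite eq_sym.
have [o neq_do] : exists o : 'I_2, d != o.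
  by case: (eqVneq d 0) => [->|d0]; [exists 1 | exists 0].
have od : o != d by rewrite eq_sym.
have ok : owned o k by rewrite (owned_other _ neq_do).
(* Each agent values both items but prefers the one owned by the other; [owner_takes] still gives
   [j] to [d] and [k] to [o]. *)
pose b := profile2 d (report y k [set j]) (report y j [set k]).
have bdE : values (b d) =1 values (report y k [set j]).
  by move=> l; rewrite /b profile2_eq.
have boE : values (b o) =1 values (report y j [set k]).
  by move=> l; rewrite /b (profile2_neq _ _ neq_do).
have bdj : values (b d) j = val x by rewrite bdE reportE (negPf jk) inE eqxx.
have bdk : values (b d) k = val y by rewrite bdE reportE eqxx.
have bok : values (b o) k = val x by rewrite boE reportE (negPf kj) inE eqxx.
have boj : values (b o) j = val y by rewrite boE reportE eqxx.
have Mdj : bundle_of (M b) d j by apply: (owner_takes neq_do dj); rewrite bdj.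
have Mok : bundle_of (M b) o k by apply: (owner_takes od ok); rewrite bok.
apply: (eff (b := b)).
(* [Y] exchanges [j] and [k] and leaves every other item in place. *)
have [Y Yd Yo] := allocation_with d
  (fun l => (l == k) || (l != j) && bundle_of (M b) d l).
have sd : sd_plus_strict (values (b d)) (bundle_of Y d) (bundle_of (M b) d).
  apply: (@sd_plus_strict_swap _ _ _ _ _ j k).
  - by rewrite bdj bdk.
  - by rewrite bdk.
  - by rewrite (bundle_of_other _ _ od) Mok.
  - by rewrite Yd eqxx.
  - by move=> l lj; rewrite Yd lj => ->; rewrite orbT.
exists Y; split; last by exists d.
move=> i; have [->|->] := ord2P neq_do i; first exact: sd.1.
have so : sd_plus_strict (values (b o)) (bundle_of Y o) (bundle_of (M b) o).
  apply: (@sd_plus_strict_swap _ _ _ _ _ k j).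
  - by rewrite boj bok.
  - by rewrite boj.
  - by rewrite (bundle_of_other _ _ neq_do) Mdj.
  - by rewrite Yo // eqxx (negPf jk).
  - move=> l lk; rewrite (bundle_of_other _ _ neq_do) Yo // (negPf lk) /=.
    by move=> /negPf->; rewrite andbF.
exact: so.1.
Qed.

Lemma efficient_serial_dictatorship : (0 < m)%N -> serial_dictatorship M.
Proof.
(* Any one item determines the dictator, since its owner owns all items. *)
move=> m_gt0; pose j0 := Ordinal m_gt0.
have [d dj0] : exists d, owned d j0.
  have [d0|d0] := boolP (owned 0 j0); first by exists 0.
  by exists 1; rewrite (owned_other (d := 0)).
exists d => b j; split=> [|i id dj ij]; last exact: (sole_positive id).
have [o neq_do] : exists o : 'I_2, d != o.
  by case: (eqVneq d 0) => [->|d_neq0]; [exists 1 | exists 0].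
exact/(owner_takes neq_do)/(owned_all _ dj0).
Qed.

End Characterization.

Theorem theorem3 (R : realType) (m : nat) (hm : (1 <= m)%N) :
  (forall M : mechanism (@nonneg_values R) 2 m,
      DSIC M -> (sd_plus_efficient_mechanism M <-> serial_dictatorship M)) /\
  (forall x y : R, 0 < x -> x < y ->
     forall M : mechanism (ternary_values x y) 2 m,
       DSIC M -> (sd_plus_efficient_mechanism M <-> serial_dictatorship M)).
Proof.
split=> [M dsic | x y x0 xy M dsic]; split=> [eff|].
(* In the nonnegative domain, 1 and 2 serve as the values [x] and [y]. *)
- have D0 : nonneg_values (0 : R) by apply: lexx.
  have D1 : nonneg_values (1 : R) by apply: ler01.
  have D2 : nonneg_values (2%:R : R) by apply: ler0n.
  apply: (@efficient_serial_dictatorship R (@nonneg_values R) m _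
    (exist _ 0 D0) (exist _ 1 D1) (exist _ 2%:R D2)) => //=.
  by rewrite ltr1n.
- exact: serial_dictatorship_efficient.
- have D0 : ternary_values x y 0 by rewrite /ternary_values eqxx.
  have Dx : ternary_values x y x by rewrite /ternary_values eqxx orbT.
  have Dy : ternary_values x y y by rewrite /ternary_values eqxx !orbT.
  apply: (@efficient_serial_dictatorship R (ternary_values x y) m _
    (exist _ 0 D0) (exist _ x Dx) (exist _ y Dy)) => //= z.
  by case/or3P=> /eqP->; rewrite ?lexx // ltW // (lt_trans x0).
- apply: serial_dictatorship_efficient => z.
  by case/or3P=> /eqP->; rewrite ?lexx // ltW // (lt_trans x0).
Qed.
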